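(* Let $p$ satisfy hypothesis (H) on $(a,b)$, let $p_h(t,0)\neq0$ for all $t\in(a,b)$, and suppose that for each $t\in(a,b)$ $$\lim_{\varepsilon\to0}\frac{\varepsilon}{h(t,\varepsilon)}\neq0,$$ where $h(t,\varepsilon)$ is the solution of $p(t,h)=t\pm\varepsilon$ from hypothesis (H). Let $f$ be continuous on $[a,b]$ and $p$-differentiable on $(a,b)$. Then there exists $c\in(a,b)$ such that $$D_pf(c)=\left[\frac{f(b)-f(a)}{b-a}\right]p_h(c,0).$$
   Context: Here $p(t,h)$ is a real-valued function defined for $t\in(a,b)$ and $|h|<\delta$, where $\delta>0$ is generally unspecified (it may depend on $t$), with values in $[a,b]$, and $p_h=\partial p/\partial h$. A function $f:[a,b]\to\mathbb{R}$ is $p$-differentiable at $t\in(a,b)$ if $$D_pf(t)=\lim_{h\to0}\frac{f(p(t,h))-f(t)}{h}$$ exists and is finite. Hypothesis (H) on $(a,b)$: for each $t\in(a,b)$, $p(t,h)$ and $p_h(t,h)$ exist and are continuous (in $h$) in a neighborhood of $h=0$; and for each $t\in(a,b)$, for each choice of sign and all sufficiently small $\varepsilon>0$, the equation $p(t,h)=t\pm\varepsilon$ has a solution $h=h(t,\varepsilon)$ such that $h\to0$ as $\varepsilon\to0$. *)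

(* Defs.v *)
From mathcomp Require Import all_boot all_order all_algebra.
From mathcomp Require Import all_classical all_reals all_analysis.
Import Order.TTheory GRing.Theory Num.Theory.
Import numFieldNormedType.Exports.

Set Implicit Arguments.
Unset Strict Implicit.
Unset Printing Implicit Defensive.

Local Open Scope classical_set_scope.
Local Open Scope ring_scope.

Definition partial_h (R : realType) (p : R -> R -> R) (t h : R) : R :=
  derive1 (p t) h.

Definition p_quotient (R : realType) (p : R -> R -> R) (f : R -> R) (t h : R)
  : R := (f (p t h) - f t) / h.

Definition p_differentiable (R : realType) (p : R -> R -> R) (f : R -> R)
  (t : R) : Prop := cvg (p_quotient p f t h @[h --> 0^']).

Definition p_derivative (R : realType) (p : R -> R -> R) (f : R -> R) (t : R)
  : R := lim (p_quotient p f t h @[h --> 0^']).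

(* [p] is a total function, but only its values at [t] in (a, b) and
   [`|h| < delta t] are meaningful. *)
Definition p_domain (R : realType) (a b : R) (delta : R -> R)
    (p : R -> R -> R) : Prop :=
  forall t, t \in `]a, b[ ->
    0 < delta t /\ (forall h, `|h| < delta t -> p t h \in `[a, b]).

(* [sol t s e] is the solution h(t, e) of p(t, h) = t + e when [s = false],
   and of p(t, h) = t - e when [s = true]. *)
Definition hypothesis_H (R : realType) (a b : R) (delta : R -> R)
    (p : R -> R -> R) (sol : R -> bool -> R -> R) : Prop :=
  (forall t, t \in `]a, b[ ->
     \forall h \near 0,
       [/\ {for h, continuous (p t)},
           derivable (p t) h 1 &
           {for h, continuous (partial_h p t)}]) /\
  (forall t, t \in `]a, b[ -> forall s : bool,
     (\forall e \near 0^'+,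
        `|sol t s e| < delta t /\ p t (sol t s e) = t + (-1) ^+ s * e) /\
     sol t s e @[e --> 0^'+] --> 0).

(* Main.v *)
Require Import Defs.
From mathcomp Require Import all_boot all_order all_algebra.
From mathcomp Require Import all_classical all_reals all_analysis.
Import Order.TTheory GRing.Theory Num.Theory.
Import numFieldNormedType.Exports.

Set Implicit Arguments.
Unset Strict Implicit.
Unset Printing Implicit Defensive.

Local Open Scope classical_set_scope.
Local Open Scope ring_scope.

(** A [p]-differentiable function is, under these hypotheses, differentiable
    in the ordinary sense, with [f'(t) = D_p f(t) / p_h(t, 0)]; the theorem is
    then the classical mean value theorem for [f].

    The point is that [p(t, 0) = t]: along the solutions [h(t, e) -> 0] of
    [p(t, h) = t + e], continuity of [p(t, .)] sends [p(t, h)] to [p(t, 0)],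
    while [t + e] tends to [t] ([p_at0]).  Hence [h(t, e)] is nonzero for small
    [e > 0], and the ordinary difference quotient of [f] at [t] factors as

      [(f(t + e) - f(t)) / e
         = ((f(p(t, h)) - f(t)) / h) / ((p(t, h) - p(t, 0)) / h)],

    whose numerator tends to [D_p f(t)] and whose denominator tends to
    [p_h(t, 0) != 0] ([cvg_quotient_reparam]).  The same computation with the
    solutions of [p(t, h) = t - e] gives the left derivative, with the same
    value ([p_differentiable_is_derive]). *)

Lemma derivable_cvg_quotient (R : realType) (q : R -> R) : derivable q 0 1 ->
  (q k - q 0) / k @[k --> 0^'] --> derive1 q 0.
Proof.
rewrite derive1E => dq.
have {}dq : h^-1 *: ((q \o shift 0) (h *: 1) - q 0) @[h --> 0^'] --> 'D_1 q 0
  by exact: dq.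
apply: cvg_trans dq; apply: near_eq_cvg; near=> k.
by rewrite /= addr0 /GRing.scale/= mulr1 mulrC.
Unshelve. all: by end_near. Qed.

(** Dividing the two difference quotients by one another removes the parameter
    [h]: a quotient of [f] taken along the curve [q] becomes a quotient of [f]
    taken at the points that [q] visits. *)
Lemma cvg_quotient_reparam (R : realType) (T : Type) (F : set_system T)
    {FF : Filter F} (f q : R -> R) (h : T -> R) (D : R) :
    derivable q 0 1 -> derive1 q 0 != 0 -> h x @[x --> F] --> 0^' ->
    (f (q k) - f (q 0)) / k @[k --> 0^'] --> D ->
  (f (q (h x)) - f (q 0)) / (q (h x) - q 0) @[x --> F] --> D / derive1 q 0.
Proof.
move=> dq q'0 h0 fD.
have num := cvg_comp _ _ h0 fD.
have den := cvg_comp _ _ h0 (derivable_cvg_quotient dq).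
have kN0 : \forall k \near (0 : R)^', k != 0 := nbhs_dnbhs_neq 0.
have hN0 : \forall x \near F, h x != 0 := h0 _ kN0.
apply: cvg_trans (cvgM num (cvgV q'0 den)); apply: near_eq_cvg.
apply: filterS hN0 => x hx.
by rewrite /= invf_div mulrA divfK.
Qed.

Lemma signed_step_cvg (R : realType) (t : R) (s : bool) :
  t + (-1) ^+ s * e @[e --> 0^'+] --> t.
Proof.
apply: cvg_at_right_filter; rewrite -[X in _ --> X]addr0.
rewrite -[X in _ + X](mulr0 ((-1) ^+ s)).
by apply: cvgD; [exact: cvg_cst|apply: cvgM; [exact: cvg_cst|exact: cvg_id]].
Qed.

Section SmallSolutions.
Context (R : realType) (a b : R) (delta : R -> R) (p : R -> R -> R)
  (sol : R -> bool -> R -> R).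
Context (pH : hypothesis_H a b delta p sol).
Context (t : R) (tab : t \in `]a, b[).

Lemma near_solE (s : bool) :
  \forall e \near 0^'+, p t (sol t s e) = t + (-1) ^+ s * e.
Proof. by have [+ _] := pH.2 t tab s; apply: filterS => e []. Qed.

Lemma derivable_p : derivable (p t) 0 1.
Proof. by have [] := nbhs_singleton (pH.1 t tab). Qed.

(** [p(t, 0)] and [t] are both limits of [p(t, h(t, e)) = t + e]. *)
Lemma p_at0 : p t 0 = t.
Proof.
have [pc _ _] := nbhs_singleton (pH.1 t tab).
have ps := cvg_comp _ _ (pH.2 t tab false).2 pc.
have pt : p t (sol t false e) @[e --> 0^'+] --> t.
  apply: cvg_trans (@signed_step_cvg R t false); apply: near_eq_cvg.
  by have := near_solE false; apply: filterS => e ->.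
exact: (cvg_unique _ ps pt).
Qed.

(** A solution at [e > 0] cannot vanish, since [p(t, 0)] differs from
    [t + e] and [t - e]. *)
Lemma cvg_sol_dnbhs (s : bool) : sol t s e @[e --> 0^'+] --> 0^'.
Proof.
move=> A A0.
have := (pH.2 t tab s).2 _ A0; have := near_solE s.
have := nbhs_right_gt (0 : R).
apply: filterS3 => e e0 pe; apply.
apply/eqP => s0; move: pe; rewrite s0 p_at0 => /eqP.
by rewrite eq_sym -subr_eq0 addrC addKr mulf_eq0 signr_eq0 (gt_eqF e0).
Qed.

Context (ph_neq0 : partial_h p t 0 != 0).

(** The solutions [h(t, e)] serve as the parameter in [cvg_quotient_reparam]:
    they visit exactly the points [t + e] (or [t - e]). *)
Lemma cvg_one_sided_quotient (f : R -> R) (s : bool) :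
    p_differentiable p f t ->
  (f (t + (-1) ^+ s * e) - f t) / ((-1) ^+ s * e) @[e --> 0^'+] -->
    p_derivative p f t / partial_h p t 0.
Proof.
move=> fD; have fD' : (f (p t k) - f (p t 0)) / k @[k --> 0^'] -->
  p_derivative p f t by rewrite p_at0.
have /(_ _) := cvg_quotient_reparam derivable_p ph_neq0 (@cvg_sol_dnbhs s) fD'.
apply: cvg_trans; apply: near_eq_cvg.
have := near_solE s; apply: filterS => e ->.
by rewrite p_at0 (addrAC t) subrr add0r.
Qed.

Lemma p_differentiable_is_derive (f : R -> R) : p_differentiable p f t ->
  is_derive t 1 f (p_derivative p f t / partial_h p t 0).
Proof.
move=> fD; set l := _ / _.
have q : (f (t + h) - f t) / h @[h --> 0^'] --> l.
  apply: (@cvg_at_right_left_dnbhs _ R^o).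
    apply: cvg_trans (@cvg_one_sided_quotient f false fD).
    by apply: near_eq_cvg; near=> h; rewrite mul1r.
  apply/cvg_at_leftNP; rewrite oppr0.
  apply: cvg_trans (@cvg_one_sided_quotient f true fD).
  by apply: near_eq_cvg; near=> h; rewrite /= mulN1r.
have {}q : h^-1 *: ((f \o shift t) (h *: 1) - f t) @[h --> 0^'] --> l.
  apply: cvg_trans q; apply: near_eq_cvg; near=> h.
  by rewrite /= /GRing.scale/= mulr1 mulrC [h + t]addrC.
by split; [apply/cvg_ex; exists l|exact: cvg_lim q].
Unshelve. all: by end_near. Qed.

End SmallSolutions.

Theorem theorem4p1 (R : realType) (a b : R) (delta : R -> R)
    (p : R -> R -> R) (sol : R -> bool -> R -> R) (f : R -> R)
    (ab : a < b)
    (p_dom : p_domain a b delta p)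
    (pH : hypothesis_H a b delta p sol)
    (ph_neq0 : forall t, t \in `]a, b[ -> partial_h p t 0 != 0)
    (lim_neq0 : forall t, t \in `]a, b[ -> forall s : bool,
       exists2 l : R, e / sol t s e @[e --> 0^'+] --> l & l != 0)
    (f_cont : {within `[a, b], continuous f})
    (f_pdiff : forall t, t \in `]a, b[ -> p_differentiable p f t) :
  exists2 c : R, c \in `]a, b[ &
    p_derivative p f c = (f b - f a) / (b - a) * partial_h p c 0.
Proof.
have fder t (tab : t \in `]a, b[) :=
  p_differentiable_is_derive pH tab (ph_neq0 t tab) (f_pdiff t tab).
have [c cab ->] := MVT ab fder f_cont.
exists c => //; rewrite mulfK ?divfK ?ph_neq0//.
by rewrite subr_eq0 gt_eqF.
Qed.
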